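(* Let $G = (I \cup J, E)$ be a finite connected bipartite graph with supplies $S_i \in \mathbb{Z}_{\geq 1}$ for $i \in I$ and capacities $C_j \in \mathbb{Z}_{\geq 1}$ for $j \in J$, and suppose that the instance has a perfect matching (i.e. a perfect integral allocation). Then the instance has a perfect proportional allocation if and only if it is matching covered.
   Context: An instance consists of a finite bipartite graph $G=(I\cup J,E)$ with bipartition $(I,J)$, integer supplies $S_i\ge 1$ for $i\in I$ and integer capacities $C_j\ge 1$ for $j\in J$. Write $i\sim j$ if $i \in I$ and $j \in J$ are adjacent. A perfect integral allocation (also called a perfect matching of the instance) is an assignment of nonnegative integers $x_{ij}$ to the edges $(i,j)\in E$ such that $\sum_{j\sim i}x_{ij}=S_i$ for every $i\in I$ and $\sum_{i\sim j}x_{ij}=C_j$ for every $j\in J$. If one exists, then $\sum_{i\in I}S_i=\sum_{j\in J}C_j=:n$, and the maximum size of a matching (allocation) is $\mathrm{OPT}=n$. A connected instance with a perfect matching is matching covered if for every edge $(i,j)\in E$ there is a perfect integral allocation $x$ with $x_{ij}>0$. Given weights $\alpha_j>0$ (real) for $j\in J$, the associated proportional allocation is $$x_{ij}:=\frac{S_i\,\alpha_j}{\sum_{j'\sim i}\alpha_{j'}}\qquad\text{for } (i,j)\in E.$$ Its value is $\sum_{j\in J}\min\bigl(C_j,\sum_{i\sim j}x_{ij}\bigr)$. A perfect proportional allocation is a proportional allocation (for some choice of positive weights) whose value equals $\mathrm{OPT}$, i.e. equals $n$ under the perfect matching assumption. *)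

(* Defs.v *)
From HB Require Import structures.
From mathcomp Require Import all_boot all_order all_algebra.
From mathcomp Require Import reals.

Set Implicit Arguments.
Unset Strict Implicit.
Unset Printing Implicit Defensive.

Import Order.TTheory GRing.Theory Num.Theory.

(* An instance is given by finite vertex sets I and J, an edge relation
   E : I -> J -> bool, supplies sup : I -> nat and capacities cap : J -> nat. *)

Definition bip_adj (I J : finType) (E : I -> J -> bool) : rel (I + J) :=
  fun u v =>
    match u, v with
    | inl i, inr j => E i j
    | inr j, inl i => E i j
    | _, _ => false
    end.

Definition bip_connected (I J : finType) (E : I -> J -> bool) : Prop :=
  forall u v : I + J, connect (bip_adj E) u v.

(* An integral assignment is a function on all of I * J, but only its values
   on the edges are ever used. *)

Definition is_allocation (I J : finType) (E : I -> J -> bool)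
    (sup : I -> nat) (cap : J -> nat) (x : I -> J -> nat) : bool :=
  [forall i, \sum_(j | E i j) x i j <= sup i] &&
  [forall j, \sum_(i | E i j) x i j <= cap j].

Definition allocation_size (I J : finType) (E : I -> J -> bool)
    (x : I -> J -> nat) : nat :=
  \sum_i \sum_(j | E i j) x i j.

(* In an allocation no edge carries more than the total supply, so the maximum
   may be taken over a finite type; see leq_OPT and OPT_attained. *)
Definition OPT (I J : finType) (E : I -> J -> bool)
    (sup : I -> nat) (cap : J -> nat) : nat :=
  \max_(x : {ffun I -> {ffun J -> 'I_(\sum_i sup i).+1}}
         | is_allocation E sup cap (fun i j => x i j))
    allocation_size E (fun i j => x i j).

Definition perfect_allocation (I J : finType) (E : I -> J -> bool)
    (sup : I -> nat) (cap : J -> nat) (x : I -> J -> nat) : Prop :=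
  (forall i, \sum_(j | E i j) x i j = sup i) /\
  (forall j, \sum_(i | E i j) x i j = cap j).

Definition matching_covered (I J : finType) (E : I -> J -> bool)
    (sup : I -> nat) (cap : J -> nat) : Prop :=
  forall i j, E i j ->
    exists x : I -> J -> nat, perfect_allocation E sup cap x /\ 0 < x i j.

Local Open Scope ring_scope.

Definition proportional_allocation (R : realType) (I J : finType)
    (E : I -> J -> bool) (sup : I -> nat) (alpha : J -> R) (i : I) (j : J) : R :=
  (sup i)%:R * alpha j / \sum_(j' | E i j') alpha j'.

Definition allocation_value (R : realType) (I J : finType)
    (E : I -> J -> bool) (cap : J -> nat) (x : I -> J -> R) : R :=
  \sum_j Num.min (cap j)%:R (\sum_(i | E i j) x i j).

Definition has_perfect_proportional_allocation (R : realType) (I J : finType)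
    (E : I -> J -> bool) (sup : I -> nat) (cap : J -> nat) : Prop :=
  exists alpha : J -> R,
    (forall j, 0 < alpha j) /\
    allocation_value E cap (proportional_allocation E sup alpha)
      = (OPT E sup cap)%:R.

Local Close Scope ring_scope.

Lemma leq_OPT (I J : finType) (E : I -> J -> bool)
    (sup : I -> nat) (cap : J -> nat) (x : I -> J -> nat) :
  is_allocation E sup cap x -> allocation_size E x <= OPT E sup cap.
Proof.
move=> Ax; have /andP[/forallP Asup _] := Ax.
have bound i j : E i j -> x i j < (\sum_i sup i).+1.
  move=> Eij; rewrite ltnS.
  have xi : x i j <= sup i.
    by apply: leq_trans (Asup i); rewrite (bigD1 j) //= leq_addr.
  by apply: leq_trans xi _; rewrite (bigD1 i) //= leq_addr.
pose y : {ffun I -> {ffun J -> 'I_(\sum_i sup i).+1}} :=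
  [ffun i => [ffun j => inord (x i j)]].
have xy i j : E i j -> (y i j : nat) = x i j.
  by move=> Eij; rewrite !ffunE inordK ?bound.
have rowE i : \sum_(j | E i j) (y i j : nat) = \sum_(j | E i j) x i j.
  by apply: eq_bigr => j; apply: xy.
have colE j : \sum_(i | E i j) (y i j : nat) = \sum_(i | E i j) x i j.
  by apply: eq_bigr => i; apply: xy.
have -> : allocation_size E x = allocation_size E (fun i j => y i j).
  by apply: eq_bigr => i _; rewrite rowE.
apply: (@leq_bigmax_cond _ _
  (fun y : {ffun I -> {ffun J -> 'I_(\sum_i sup i).+1}} =>
     allocation_size E (fun i j => y i j))).
have /andP[_ /forallP Acap] := Ax.
by apply/andP; split; apply/forallP => k; rewrite ?rowE ?colE.
Qed.

Lemma OPT_attained (I J : finType) (E : I -> J -> bool)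
    (sup : I -> nat) (cap : J -> nat) :
  exists2 x : I -> J -> nat,
    is_allocation E sup cap x & allocation_size E x = OPT E sup cap.
Proof.
pose T : finType := {ffun I -> {ffun J -> 'I_(\sum_i sup i).+1}}.
pose P (x : T) := is_allocation E sup cap (fun i j => x i j).
have P0 : P [ffun=> [ffun=> ord0]].
  by apply/andP; split; apply/forallP => k; rewrite big1 // => l _; rewrite !ffunE.
have [|x Px eqx] := @eq_bigmax_cond T P
  (fun x => allocation_size E (fun i j => x i j)).
  by apply/card_gt0P; exists [ffun=> [ffun=> ord0]].
by exists (fun i j => nat_of_ord (x i j)).
Qed.

(* Main.v *)
(* If a proportional allocation is perfect, every load equals its capacity, so
   it is a fractional perfect allocation that is positive on all edges.  Given
   an integral perfect allocation x and an edge (i, j) with x i j = 0, its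
   residual graph has a path from j to i: otherwise the set reachable from j
   would be tight, and the fractional allocation would overload it through
   (i, j).  Augmenting along a simple residual cycle makes x i j positive.

   Conversely, consider the scale-invariant function
     potential al = (prod_j al_j ^ C_j) / (prod_i (sum_(j ~ i) al_j) ^ S_i).
   If m is a sum of N integral perfect allocations that is positive on every
   edge, then potential al ^ N is the product over the edges (i, j) of
   (al_j / sum_(j' ~ i) al_j') ^ m_ij, whose factors are at most 1.  Hence on a
   superlevel set all these ratios, and by connectivity all quotients
   al_j / al_j', are bounded below, so that a maximum exists by compactness.
   A Sinkhorn step al_j |-> al_j * C_j / load_j strictly increases the
   potential unless load = C (by t <= exp (t - 1)), so at a maximum the
   proportional allocation is perfect. *)
Require Import Defs.
From mathcomp Require Import all_boot all_order all_algebra.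
From mathcomp Require Import reals boolp classical_sets topology normedtype.
From mathcomp Require Import derive sequences exp function_spaces realfun.

Set Implicit Arguments.
Unset Strict Implicit.
Unset Printing Implicit Defensive.

Import Order.TTheory GRing.Theory Num.Theory numFieldNormedType.Exports.

(** * Residual graphs and augmentation along cycles *)

Section Combinatorics.
Context (I J : finType) (E : I -> J -> bool) (sup : I -> nat) (cap : J -> nat).
Implicit Types (x : I -> J -> nat).

Lemma perfect_sum_sup_cap x :
  perfect_allocation E sup cap x -> \sum_i sup i = \sum_j cap j.
Proof.
case=> xs xc; under eq_bigr do rewrite -xs; under [RHS]eq_bigr do rewrite -xc.
by rewrite (exchange_big_dep predT).
Qed.

Lemma perfect_OPT x :
  perfect_allocation E sup cap x -> OPT E sup cap = \sum_j cap j.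
Proof.
move=> xP; apply/eqP; rewrite eqn_leq; apply/andP; split.
  have [y /andP[/forallP ys _] <-] := OPT_attained E sup cap.
  by rewrite -(perfect_sum_sup_cap xP); apply: leq_sum => i _; apply: ys.
case: (xP) => xs xc.
have <- : allocation_size E x = \sum_j cap j.
  rewrite -(perfect_sum_sup_cap xP); apply: eq_bigr => i _; exact: xs.
by apply: leq_OPT; apply/andP; split; apply/forallP => k; rewrite ?xs ?xc.
Qed.

Definition residual x : rel (I + J) :=
  fun u v =>
    match u, v with
    | inl i, inr j => E i j
    | inr j, inl i => E i j && (0 < x i j)
    | _, _ => false
    end.

(* The truncated subtraction is exact when c is a simple residual cycle. *)
Definition augment (c : seq (I + J)) x i j : nat :=
  x i j + (next c (inl i) == inr j) - (next c (inr j) == inl i).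

Lemma sum_eq_op (T : finType) (P : pred T) (k0 : T) :
  P k0 -> \sum_(k | P k) (k == k0 : nat) = 1.
Proof.
move=> Pk0; rewrite (bigD1 k0) //= eqxx big1 // => k /andP[_ /negbTE ->] //.
Qed.

Lemma next_id (T : eqType) (c : seq T) u : u \notin c -> next c u = u.
Proof. by rewrite next_nth => /negbTE ->. Qed.

Lemma prev_id (T : eqType) (c : seq T) u : u \notin c -> prev c u = u.
Proof. by rewrite prev_nth => /negbTE ->. Qed.

(** A simple cycle enters and leaves each of its vertices once, so one unit is gained on one
    incident edge and one lost on another, or on the same one. Off the cycle [next] and [prev] are
    the identity and never match a vertex of the other side. *)
Lemma augment_perfect c x :
  cycle (residual x) c -> uniq c ->
  perfect_allocation E sup cap x -> perfect_allocation E sup cap (augment c x).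
Proof.
move=> cc uc [xs xc].
(* A cycle arc from j back to i is residual, so there is a unit to remove. *)
have le_back i j :
    (next c (inr j) == inl i) <= x i j + (next c (inl i) == inr j).
  case: eqP => // nji; apply: leq_trans (leq_addr _ _).
  have jc : inr j \in c by apply: contraT => /(@next_id _ _ _); rewrite nji.
  by have := next_cycle cc jc; rewrite nji => /andP[].
have backE u v : (next c u == v) = (u == prev c v).
  by apply/eqP/eqP => [<-|->]; rewrite (prev_next, next_prev).
split=> [i|j].
(* Adding the removed units to both sides eliminates the truncated subtraction. *)
- apply/eqP; rewrite -(eqn_add2r (\sum_(j | E i j) (next c (inr j) == inl i))).
  rewrite -big_split /=.
  under eq_bigr do rewrite subnK //.
  rewrite big_split /= xs eqn_add2l.
  have [ic|ic] := boolP (inl i \in c); last first.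
    rewrite big1 => [|j _]; last by rewrite (next_id ic).
    by rewrite big1 => // j _; rewrite backE (prev_id ic).
  have := next_cycle cc ic; case ni : (next c (inl i)) => [//|j0] /= Ej0.
  have := prev_cycle cc ic; case pi : (prev c (inl i)) => [//|j1] /andP[Ej1 _].
  under eq_bigr do rewrite eq_sym (inj_eq (@inr_inj _ _)).
  under [X in _ == X]eq_bigr do rewrite backE pi (inj_eq (@inr_inj _ _)).
  by rewrite !sum_eq_op.
- apply/eqP; rewrite -(eqn_add2r (\sum_(i | E i j) (next c (inr j) == inl i))).
  rewrite -big_split /=.
  under eq_bigr do rewrite subnK //.
  rewrite big_split /= xc eqn_add2l.
  have [jc|jc] := boolP (inr j \in c); last first.
    rewrite big1 => [|i _]; last by rewrite backE (prev_id jc).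
    by rewrite big1 => // i _; rewrite (next_id jc).
  have := next_cycle cc jc; case nj : (next c (inr j)) => [i0|//] /= /andP[Ei0 _].
  have := prev_cycle cc jc; case pj : (prev c (inr j)) => [i1|//] /= Ei1.
  under eq_bigr do rewrite backE pj (inj_eq (@inl_inj _ _)).
  under [X in _ == X]eq_bigr do rewrite eq_sym (inj_eq (@inl_inj _ _)).
  by rewrite !sum_eq_op.
Qed.

Lemma residual_path_covered x i j :
  perfect_allocation E sup cap x -> E i j ->
  connect (residual x) (inr j) (inl i) ->
  exists y, perfect_allocation E sup cap y /\ 0 < y i j.
Proof.
move=> xP Eij /connectP[p0 /shortenP[p pp up _] {p0}].
have [|xij0] := posnP (x i j); last by exists x.
move=> xij0; case/lastP: p pp up => [//|p i'] pp up; rewrite last_rcons => def_i.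
subst i'; pose c := inl i :: inr j :: p.
have cc : cycle (residual x) c by rewrite /= Eij; exact: pp.
have uc : uniq c by rewrite -(rot_uniq 1) rot1_cons.
exists (augment c x); split; first exact: augment_perfect.
have nij : next c (inl i) = inr j by rewrite /= eqxx.
(* The unit gained on (i, j) is not lost again: an arc from j to i would need [0 < x i j]. *)
rewrite /augment xij0 nij eqxx; case: eqP => // nji.
have /(next_cycle cc) : inr j \in c by rewrite !inE eqxx orbT.
by rewrite nji /= xij0 andbF.
Qed.

Local Open Scope ring_scope.

Lemma fractional_residual_connected (R : numDomainType) (y : I -> J -> R) x i j :
  (forall i j, E i j -> 0 < y i j) ->
  (forall i, \sum_(j | E i j) y i j = (sup i)%:R) ->
  (forall j, \sum_(i | E i j) y i j = (cap j)%:R) ->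
  perfect_allocation E sup cap x -> E i j ->
  connect (residual x) (inr j) (inl i).
Proof.
move=> y0 ys yc [xs xc] Eij; apply: contraT => niT.
pose T := connect (residual x) (inr j).
have TIJ i' j' : E i' j' -> T (inl i') -> T (inr j').
  by move=> Ei Ti; apply: connect_trans Ti (connect1 _).
have TJI i' j' : E i' j' -> T (inr j') -> (0 < x i' j')%N -> T (inl i').
  by move=> Ei Tj x0; apply: connect_trans Tj (connect1 _); rewrite /= Ei.
(* In [x], the supplies in T go only to T by [TIJ], and the capacities in T are filled only from T
   by [TJI]. *)
have tight : (\sum_(j' | T (inr j')) cap j' = \sum_(i' | T (inl i')) sup i')%N.
  under eq_bigr do rewrite -xc; under [RHS]eq_bigr do rewrite -xs.
  rewrite (exchange_big_dep predT) //= [RHS]big_mkcond; apply: eq_bigr => i' _.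
  case: ifP => Ti.
    by apply: eq_bigl => j'; case Ei: (E i' j'); rewrite ?andbF // (TIJ i').
  rewrite big1 // => j' /andP[Tj Ei]; apply/eqP; rewrite -leqn0 leqNgt.
  by apply: contraFN Ti; apply: TJI.
(* In [y], T also receives all of its own supply, and in addition the positive amount [y i j] from i
   outside T. *)
suff : (\sum_(i' | T (inl i')) sup i')%:R < (\sum_(j' | T (inr j')) cap j')%:R :> R.
  by rewrite tight ltxx.
rewrite !natr_sum; under eq_bigr do rewrite -ys; under [ltRHS]eq_bigr do rewrite -yc.
rewrite [ltRHS](exchange_big_dep predT) //= big_mkcond /=.
rewrite (bigD1 i) // [ltRHS](bigD1 i) //= ifN // ltr_leD //.
  rewrite (bigD1 j) //=; last by rewrite /T connect0.
  rewrite ltr_pwDl ?y0 //; apply: sumr_ge0 => j' /andP[/andP[_ Ei] _].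
  exact/ltW/y0.
apply: ler_sum => i' _; case: ifP => Ti; last first.
  by apply: sumr_ge0 => j' /andP[_ Ei]; exact/ltW/y0.
rewrite le_eqVlt; apply/orP; left; apply/eqP; apply: eq_bigl => j'.
by case Ei: (E i' j'); rewrite ?andbF // (TIJ i').
Qed.

Lemma fractional_matching_covered (R : numDomainType) (y : I -> J -> R) x :
  (forall i j, E i j -> 0 < y i j) ->
  (forall i, \sum_(j | E i j) y i j = (sup i)%:R) ->
  (forall j, \sum_(i | E i j) y i j = (cap j)%:R) ->
  perfect_allocation E sup cap x -> matching_covered E sup cap.
Proof.
move=> y0 ys yc xP i j Eij; apply: (residual_path_covered xP Eij).
exact: (fractional_residual_connected y0 ys yc xP Eij).
Qed.

End Combinatorics.

(** * Path estimates, exponential bounds and maxima on boxes *)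

Local Open Scope ring_scope.

(** A simple path has at most [#|T|] steps, each costing a factor [eps]; since [eps <= 1], the
    exponent can be raised to [#|T|]. *)
Lemma connect_geometric_le (R : numDomainType) (T : finType) (e : rel T)
    (b : T -> R) (eps : R) u v :
  0 <= eps <= 1 -> (forall w, 0 <= b w) ->
  (forall w w', e w w' -> eps * b w <= b w') ->
  connect e u v -> eps ^+ #|T| * b u <= b v.
Proof.
move=> /andP[eps0 eps1] b0 eb /connectP[p0 /shortenP[p pp up _] {p0} ->].
have sp : (size p <= #|T|)%N.
  by have := max_card [in u :: p]; rewrite (card_uniqP up); apply: ltnW.
apply: (@le_trans _ _ (eps ^+ size p * b u)).
  by rewrite ler_wpM2r // ler_wiXn2l.
elim: p u pp {up sp} => [|w p IHp] u /=; first by rewrite mul1r.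
case/andP=> euw pp; apply: le_trans (IHp w pp).
by rewrite exprSr -mulrA ler_wpM2l ?exprn_ge0 ?eb.
Qed.

(** A form of weighted AM-GM: when the weighted deviations of [t] from 1 sum to zero, the bound is
    1. *)
Lemma prod_expn_le_expR (R : realType) (K : finType) (w : K -> nat) (t : K -> R) :
  (forall k, 0 <= t k) ->
  \prod_k t k ^+ w k <= expR (\sum_k (w k)%:R * (t k - 1)).
Proof.
move=> t0; rewrite expR_sum; apply: ler_prod => k _.
rewrite exprn_ge0 //= expRM_natl; apply: lerXn2r; rewrite ?nnegrE ?expR_ge0 //.
by have := expR_ge1Dx (t k - 1); rewrite addrC subrK.
Qed.

Lemma prod_expn_lt_expR (R : realType) (K : finType) (w : K -> nat) (t : K -> R) k0 :
  (forall k, 0 < t k) -> (0 < w k0)%N -> t k0 != 1 ->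
  \prod_k t k ^+ w k < expR (\sum_k (w k)%:R * (t k - 1)).
Proof.
move=> t0 w0 t1; rewrite expR_sum (bigD1 k0) // [ltRHS](bigD1 k0) //=.
have X0 k : 0 <= t k ^+ w k by rewrite exprn_ge0 // ltW.
have leX k : t k ^+ w k <= expR ((w k)%:R * (t k - 1)).
  rewrite expRM_natl lerXn2r ?nnegrE ?expR_ge0 ?(ltW (t0 _)) //.
  by have := expR_ge1Dx (t k - 1); rewrite addrC subrK.
have ltX : t k0 ^+ w k0 < expR ((w k0)%:R * (t k0 - 1)).
  rewrite expRM_natl ltrXn2r -?lt0n ?w0 ?nnegrE ?expR_ge0 ?(ltW (t0 _)) //.
  have nz : t k0 - 1 != 0 by rewrite subr_eq0.
  by have := expR_gt1Dx nz; rewrite addrC subrK.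
have le_rest : \prod_(k | k != k0) t k ^+ w k
    <= \prod_(k | k != k0) expR ((w k)%:R * (t k - 1)).
  by apply: ler_prod => k _; rewrite X0 leX.
apply: le_lt_trans (ler_wpM2l (X0 k0) le_rest) _.
by rewrite ltr_pM2r // prodr_gt0 // => k _; exact: expR_gt0.
Qed.

(** The box is compact by Tychonoff. Continuity is asked only at its points, since the potential is
    a quotient whose denominator may vanish elsewhere. *)
Lemma box_max (R : realType) (J : finType) (a b : R) (f : (J -> R) -> R) :
  a <= b ->
  {in [set al : prod_topology (fun _ : J => R)
        | forall j, `[a, b]%classic (al j)]%classic,
    continuous (f : prod_topology (fun _ : J => R) -> R)} ->
  exists2 al : J -> R, (forall j, a <= al j <= b) &
    forall al', (forall j, a <= al' j <= b) -> f al' <= f al.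
Proof.
move=> ab fc.
set A := (X in {in X, _}) in fc.
have cA : compact A.
  exact: (@tychonoff J (fun=> R) (fun=> `[a, b]%classic)
           (fun=> @segment_compact R a b)).
have A0 : (A !=set0)%classic.
  by exists (fun=> a) => j /=; rewrite in_itv /= lexx ab.
have [al alA almax] := compact_EVT_max A0 cA (continuous_in_subspaceT fc).
exists al => [j|al' al'A].
  by move: alA; rewrite inE => /(_ j); rewrite /= in_itv.
by apply: almax; rewrite inE => j /=; rewrite in_itv /=.
Qed.

Lemma continuous_at_prod (R : realType) (T : topologicalType) (K : Type)
    (r : seq K) (P : pred K) (f : K -> T -> R) x :
  (forall k, P k -> {for x, continuous (f k)}) ->
  {for x, continuous (fun y => \prod_(k <- r | P k) f k y)}.
Proof.
move=> fc.
exact: (@cvg_big R K *%R 1 P (@mul_continuous R) T (nbhs x) r f (f ^~ x) _ fc).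
Qed.

Lemma continuous_at_sum (R : realType) (T : topologicalType) (K : Type)
    (r : seq K) (P : pred K) (f : K -> T -> R) x :
  (forall k, P k -> {for x, continuous (f k)}) ->
  {for x, continuous (fun y => \sum_(k <- r | P k) f k y)}.
Proof.
move=> fc.
exact: (@cvg_big R K +%R 0 P (@add_continuous R^o) T (nbhs x) r f (f ^~ x) _ fc).
Qed.

(** * The potential and its increase under a Sinkhorn step *)

Section Potential.
Context (R : realType) (I J : finType) (E : I -> J -> bool).
Context (sup : I -> nat) (cap : J -> nat).
Implicit Types al : J -> R.

Definition weight_sum al i : R := \sum_(j | E i j) al j.

Definition load al j : R :=
  \sum_(i | E i j) proportional_allocation E sup al i j.

(** At positive weights, the derivative of its logarithm with respect to the logarithm of [al j] is
    [cap j - load al j], so its critical points are the weights sought. *)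
Definition potential al : R :=
  (\prod_j al j ^+ cap j) / \prod_i weight_sum al i ^+ sup i.

Hypothesis I_nbr : forall i, exists j, E i j.
Hypothesis J_nbr : forall j, exists i, E i j.

Lemma sumr_pred_gt0 (K : finType) (P : pred K) (F : K -> R) :
  (exists k, P k) -> (forall k, P k -> 0 < F k) -> 0 < \sum_(k | P k) F k.
Proof.
case=> k0 Pk0 F0; rewrite (bigD1 k0) //= ltr_pwDl ?F0 //.
by apply: sumr_ge0 => k /andP[Pk _]; rewrite ltW ?F0.
Qed.

Lemma weight_sum_gt0 al i : (forall j, 0 < al j) -> 0 < weight_sum al i.
Proof. by move=> al0; apply: sumr_pred_gt0. Qed.

Lemma potential_gt0 al : (forall j, 0 < al j) -> 0 < potential al.
Proof.
move=> al0; apply: divr_gt0; apply: prodr_gt0 => k _; apply: exprn_gt0 => //.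
exact: weight_sum_gt0.
Qed.

Lemma ratio_itv al i j : (forall j, 0 < al j) -> E i j ->
  0 < al j / weight_sum al i <= 1.
Proof.
move=> al0 Eij; have A0 := weight_sum_gt0 i al0.
rewrite divr_gt0 //= ler_pdivrMr // mul1r /weight_sum (bigD1 j) //= lerDl.
by apply: sumr_ge0 => k _; exact: ltW.
Qed.

Lemma proportional_row al i : (forall j, 0 < al j) ->
  \sum_(j | E i j) proportional_allocation E sup al i j = (sup i)%:R.
Proof.
move=> al0; have /lt0r_neq0 A0 := weight_sum_gt0 i al0.
by rewrite -mulr_suml -mulr_sumr mulfK.
Qed.

Lemma sum_load al : (forall j, 0 < al j) ->
  \sum_j load al j = (\sum_i sup i)%:R.
Proof.
move=> al0; rewrite (exchange_big_dep predT) //= natr_sum.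
by apply: eq_bigr => i _; exact: proportional_row.
Qed.

Hypothesis sum_sup_cap : (\sum_i sup i = \sum_j cap j)%N.

(** Full value forces each minimum to be the capacity, so no load is below its capacity; the totals
    agree, so no load is above it. *)
Lemma allocation_value_load al : (forall j, 0 < al j) ->
  allocation_value E cap (proportional_allocation E sup al) = (\sum_j cap j)%:R
  <-> forall j, load al j = (cap j)%:R.
Proof.
move=> al0; rewrite natr_sum; split=> [val j|loadE]; last first.
  by apply: eq_bigr => j _; rewrite -/(load al j) loadE minxx.
have cap_le k : (cap k)%:R <= load al k.
  apply/min_idPl/esym/eqP; rewrite -subr_eq0; apply/eqP; move: k (erefl true).
  apply: psumr_eq0P => [k _|]; first by rewrite subr_ge0 ge_min lexx.
  by rewrite sumrB -val subrr.
apply/eqP; rewrite -subr_eq0; apply/eqP; move: j (erefl true).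
apply: psumr_eq0P => [j _|]; first by rewrite subr_ge0.
by rewrite sumrB sum_load // sum_sup_cap natr_sum subrr.
Qed.

(** Numerator and denominator are homogeneous of the same degree. *)
Lemma potential_scale c al :
  c != 0 -> potential (fun j => c * al j) = potential al.
Proof.
move=> c0; rewrite /potential.
under eq_bigr do rewrite exprMn.
under [X in _ / X]eq_bigr do rewrite /weight_sum -mulr_sumr exprMn.
rewrite !big_split /= !prodrXr sum_sup_cap invfM mulrACA divff ?mul1r //.
by rewrite expf_neq0.
Qed.

Hypothesis sup_gt0 : forall i, (0 < sup i)%N.
Hypothesis cap_gt0 : forall j, (0 < cap j)%N.

Lemma load_gt0 al j : (forall j, 0 < al j) -> 0 < load al j.
Proof.
move=> al0; apply: sumr_pred_gt0 => // i _.
by rewrite divr_gt0 ?mulr_gt0 ?ltr0n //; exact: weight_sum_gt0.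
Qed.

(* One round of Sinkhorn's iteration. *)
Lemma potential_sinkhorn_lt al j0 :
  (forall j, 0 < al j) -> load al j0 <> (cap j0)%:R ->
  potential al < potential (fun j => al j * ((cap j)%:R / load al j)).
Proof.
move=> al0 ne0; set al' := (X in _ < potential X).
have L0 j := load_gt0 j al0; have A0 i := weight_sum_gt0 i al0.
have C0 j : 0 < (cap j)%:R :> R by rewrite ltr0n.
have al'0 j : 0 < al' j by rewrite mulr_gt0 ?divr_gt0.
have A'0 i := weight_sum_gt0 i al'0.
(* The step divides the numerator of the potential by [P] and multiplies its denominator by [Q], so
   it suffices that [P * Q < 1]. *)
pose P := \prod_j (load al j / (cap j)%:R) ^+ cap j.
pose Q := \prod_i (weight_sum al' i / weight_sum al i) ^+ sup i.
have P0 : 0 < P by apply: prodr_gt0 => j _; rewrite exprn_gt0 ?divr_gt0.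
have Q0 : 0 < Q by apply: prodr_gt0 => i _; rewrite exprn_gt0 ?divr_gt0.
have P1 : P < 1.
  have sum0 : \sum_j (cap j)%:R * (load al j / (cap j)%:R - 1) = 0.
    under eq_bigr do rewrite mulrBr mulr1 mulrCA divff ?mulr1 ?lt0r_neq0 //.
    by rewrite sumrB sum_load // sum_sup_cap natr_sum subrr.
  rewrite -(@expR0 R) -sum0; apply: (@prod_expn_lt_expR _ _ _ _ j0) => //.
    by move=> j; rewrite divr_gt0.
  by apply/eqP => /divr1_eq.
have Q1 : Q <= 1.
  have sum0 : \sum_i (sup i)%:R * (weight_sum al' i / weight_sum al i - 1) = 0.
    under eq_bigr do rewrite mulrBr mulr1.
    rewrite sumrB -[X in _ - X]natr_sum sum_sup_cap natr_sum.
    apply/eqP; rewrite subr_eq0; apply/eqP.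
    (* Regrouped by j, the new weight sums weighted by [sup i / weight_sum al i] give each load
       times its correction factor, which is [cap j]. *)
    transitivity (\sum_j load al j * ((cap j)%:R / load al j)); last first.
      by apply: eq_bigr => j _; rewrite mulrC divfK ?lt0r_neq0.
    under [RHS]eq_bigr do rewrite mulr_suml.
    rewrite [RHS](exchange_big_dep predT) //=; apply: eq_bigr => i _.
    rewrite mulr_suml mulr_sumr; apply: eq_bigr => j _.
    by rewrite [RHS]mulrAC !mulrA.
  rewrite -(@expR0 R) -sum0; apply: prod_expn_le_expR => i.
  by rewrite divr_ge0 ?ltW.
have -> : potential al' = potential al * (P * Q)^-1.
  have -> : potential al' = ((\prod_j al j ^+ cap j) * P^-1)
                            / ((\prod_i weight_sum al i ^+ sup i) * Q).
    congr (_ / _).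
    - rewrite -prodfV -big_split /=; apply: eq_bigr => j _.
      by rewrite -exprVn -exprMn invf_div.
    - rewrite -big_split /=; apply: eq_bigr => i _.
      by rewrite -exprMn mulrC divfK ?lt0r_neq0.
  by rewrite /potential !invfM mulrACA.
rewrite ltr_pMr ?potential_gt0 // invf_gt1 ?mulr_gt0 //.
by apply: le_lt_trans P1; rewrite ler_piMr // ltW.
Qed.

(** * Coercivity of the potential and existence of a maximum *)

Section Coercivity.
Context (N : nat) (m : I -> J -> nat).
Hypothesis m_gt0 : forall i j, E i j -> (0 < m i j)%N.
Hypothesis m_sup : forall i, (\sum_(j | E i j) m i j = sup i * N)%N.
Hypothesis m_cap : forall j, (\sum_(i | E i j) m i j = cap j * N)%N.

Lemma potential_exprE al :
  potential al ^+ N =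
  \prod_i \prod_(j | E i j) (al j / weight_sum al i) ^+ m i j.
Proof.
rewrite expr_div_n -!prodrXl.
under [RHS]eq_bigr => i _.
  under eq_bigr do rewrite expr_div_n.
  rewrite prodf_div prodrXr m_sup exprM.
  over.
rewrite [RHS]prodf_div; congr (_ / _).
rewrite [RHS](exchange_big_dep predT) //=; apply: eq_bigr => j _.
by rewrite prodrXr m_cap exprM.
Qed.

(** A product of factors in [0, 1] is at most any one of them; [m i j > 0] ensures that the ratio of
    (i, j) occurs. *)
Lemma potential_expr_le al i j : (forall j, 0 < al j) -> E i j ->
  potential al ^+ N <= al j / weight_sum al i.
Proof.
move=> al0 Eij.
have X01 i' j' : E i' j' -> 0 <= (al j' / weight_sum al i') ^+ m i' j' <= 1.
  move=> /(ratio_itv al0)/andP[q0 q1].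
  by rewrite exprn_ge0 ?exprn_ile1 // ltW.
have P01 i' (S : pred J) :
    0 <= \prod_(j' | E i' j' && S j') (al j' / weight_sum al i') ^+ m i' j' <= 1.
  apply/andP; split; [apply: prodr_ge0|apply: prodr_ile1] => j' /andP[/X01] //.
  by case/andP.
have := ratio_itv al0 Eij; rewrite potential_exprE (bigD1 i) //= (bigD1 j) //=.
move: (al j / _) => q /andP[q0 q1]; rewrite -mulrA.
rewrite -(prednK (m_gt0 Eij)) exprS -mulrA ler_piMr ?(ltW q0) //.
rewrite mulr_ile1 ?exprn_ge0 ?exprn_ile1 ?(ltW q0) //.
- have /andP[r0 r1] := P01 i (predC1 j).
  rewrite mulr_ge0 //; apply: prodr_ge0 => i' _.
  by have /andP[] := P01 i' predT; rewrite (eq_bigl (E i')) // => j'; rewrite andbT.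
- have /andP[r0 r1] := P01 i (predC1 j).
  have R01 i' : 0 <= \prod_(j' | E i' j') (al j' / weight_sum al i') ^+ m i' j' <= 1.
    by have := P01 i' predT; rewrite (eq_bigl (E i')) // => j'; rewrite andbT.
  rewrite mulr_ile1 //; first by apply: prodr_ge0 => i' _; case/andP: (R01 i').
  by apply: prodr_ile1.
Qed.

Hypothesis Econn : bip_connected E.

(** Follow a path in the graph, with [weight_sum] as the value at vertices of I. A step from I to J
    costs at most a factor [c ^+ N]; a step from J to I costs nothing, since a weight is at most the
    sum containing it. *)
Lemma superlevel_ratio al c j j' : (forall j, 0 < al j) ->
  0 < c -> c <= potential al ->
  (c ^+ N) ^+ #|{: I + J}| * al j <= al j'.
Proof.
move=> al0 c0 cal; have cN0 : 0 <= c ^+ N by rewrite exprn_ge0 // ltW.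
have cN i k : E i k -> c ^+ N <= al k / weight_sum al i.
  move=> Eik; apply: le_trans (potential_expr_le al0 Eik).
  by rewrite lerXn2r ?nnegrE // ltW // potential_gt0.
have cN1 : c ^+ N <= 1.
  have [i Eij] := J_nbr j; apply: le_trans (cN _ _ Eij) _.
  by case/andP: (ratio_itv al0 Eij).
pose b (w : I + J) := match w with inl i => weight_sum al i | inr k => al k end.
have b0 w : 0 < b w by case: w => [i|k] //=; exact: weight_sum_gt0.
apply: (@connect_geometric_le _ _ (bip_adj E) b _ (inr j) (inr j')) => //.
- exact/andP.
- by move=> w; exact: ltW.
- have A0 i := weight_sum_gt0 i al0.
  move=> [i|k] [i'|k'] //= Ew; first by rewrite -ler_pdivlMr // cN.
  have /andP[_] := ratio_itv al0 Ew; rewrite ler_pdivrMr // mul1r.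
  by apply: le_trans; rewrite ler_piMl // ltW.
Qed.

Lemma potential_continuous al : (forall j, 0 < al j) ->
  {for al, continuous (potential : prod_topology (fun _ : J => R) -> R)}.
Proof.
move=> al0; pose X : topologicalType := prod_topology (fun _ : J => R).
have cX (f : X -> R) n :
    {for al, continuous f} -> {for al, continuous (fun x => f x ^+ n)}.
  move=> cf; apply: (@continuous_comp _ _ _ f (fun y => y ^+ n) al) => //.
  exact: exprn_continuous.
have cproj j : {for al, continuous (fun x : X => x j)}.
  exact: (@proj_continuous _ (fun _ : J => R) j al).
have cnum : {for al, continuous (fun x : X => \prod_j x j ^+ cap j)}.
  by apply: (@continuous_at_prod R X) => j _; exact: (cX _ _ (cproj j)).
have csum i : {for al, continuous (fun x : X => weight_sum x i)}.
  by apply: (@continuous_at_sum R X) => j _; exact: cproj.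
have cden : {for al, continuous (fun x : X => \prod_i weight_sum x i ^+ sup i)}.
  by apply: (@continuous_at_prod R X) => i _; exact: (cX _ _ (csum i)).
apply: (continuousM cnum (continuousV _ cden)).
by apply/prodf_neq0 => i _; rewrite expf_neq0 // lt0r_neq0 // weight_sum_gt0.
Qed.

Lemma potential_max : exists2 al : J -> R,
  (forall j, 0 < al j) &
  forall al', (forall j, 0 < al' j) -> potential al' <= potential al.
Proof.
have [j0 _|J0] := pickP (xpredT : pred J); last first.
  exists (fun=> 1) => // al' _; suff -> : al' = fun=> 1 by [].
  by apply/boolp.funext => j; have := J0 j.
pose one : J -> R := fun=> 1.
have one0 j : 0 < one j by exact: ltr01.
(* The ratio bound of [superlevel_ratio] at the level of the constant weights [one]. *)
pose d : R := (potential one ^+ N) ^+ #|{: I + J}|.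
have d0 : 0 < d by rewrite !exprn_gt0 ?potential_gt0.
have d1 : d <= 1.
  have := superlevel_ratio j0 j0 one0 (potential_gt0 one0) (lexx _).
  by rewrite mulr1.
have dV : 1 <= d^-1 by rewrite invf_ge1.
have box0 al : (forall j, d <= al j <= d^-1) -> forall j, 0 < al j.
  by move=> box j; apply: lt_le_trans d0 _; case/andP: (box j).
have [|al albox almax] := @box_max R J d d^-1 potential (le_trans d1 dV).
  move=> al; rewrite inE => box; apply: potential_continuous => j.
  by have := box j; rewrite /= in_itv /= => /andP[/(lt_le_trans d0)].
exists al => [|al' al'0]; first exact: box0.
(* Weights below the level of [one] are beaten because [one] lies in the box; all others enter the
   box once rescaled to have value 1 at [j0]. *)
have [lt1|le1] := ltP (potential al') (potential one).
  by apply: le_trans (ltW lt1) _; apply: almax => j; rewrite d1.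
have /lt0r_neq0 nz : 0 < (al' j0)^-1 by rewrite invr_gt0.
rewrite -(potential_scale al' nz); apply: almax => j.
have le j1 j2 := superlevel_ratio j1 j2 al'0 (potential_gt0 one0) le1.
rewrite mulrC ler_pdivlMr // le /= ler_pdivrMr //.
by rewrite -ler_pdivrMl ?invr_gt0 // invrK le.
Qed.

Lemma loads_eq_cap : exists2 al : J -> R,
  (forall j, 0 < al j) & forall j, load al j = (cap j)%:R.
Proof.
have [al al0 almax] := potential_max; exists al => // j; apply/eqP.
apply: contraT => /eqP /(potential_sinkhorn_lt al0).
rewrite ltNge almax // => k; rewrite mulr_gt0 ?divr_gt0 ?ltr0n //.
exact: load_gt0.
Qed.

End Coercivity.
End Potential.

(* A positive sum of allocations, and the equivalence *)
Local Close Scope ring_scope.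

Lemma matching_covered_positive (I J : finType) (E : I -> J -> bool)
    (sup : I -> nat) (cap : J -> nat) x :
  perfect_allocation E sup cap x -> matching_covered E sup cap ->
  exists N (m : I -> J -> nat),
    [/\ forall i j, E i j -> 0 < m i j,
        forall i, \sum_(j | E i j) m i j = sup i * N &
        forall j, \sum_(i | E i j) m i j = cap j * N].
Proof.
move=> xP cov.
(* One allocation per pair, with [x] as default off the edges, so that [N] is simply the number of
   pairs. *)
have /fin_all_exists[y yP] (e : I * J) : exists y,
    perfect_allocation E sup cap y /\ (E e.1 e.2 -> 0 < y e.1 e.2).
  have [/cov[y [yP y0]]|] := boolP (E e.1 e.2); first by exists y.
  by exists x.
exists #|{: I * J}|, (fun i j => \sum_e y e i j); split=> [i j Eij|i|j].
- by rewrite (bigD1 (i, j)) //= addn_gt0 ((yP (i, j)).2 Eij).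
- rewrite exchange_big /= mulnC -sum_nat_const; apply: eq_bigr => e _.
  exact: (yP e).1.1.
- rewrite exchange_big /= mulnC -sum_nat_const; apply: eq_bigr => e _.
  exact: (yP e).1.2.
Qed.

Theorem theorem3p1 (R : realType) (I J : finType) (E : I -> J -> bool)
    (sup : I -> nat) (cap : J -> nat)
    (sup_ge1 : forall i, 1 <= sup i) (cap_ge1 : forall j, 1 <= cap j)
    (Econn : bip_connected E)
    (Eperfect : exists x : I -> J -> nat, perfect_allocation E sup cap x) :
  has_perfect_proportional_allocation R E sup cap <-> matching_covered E sup cap.
Proof.
have [x xP] := Eperfect; have sumE := perfect_sum_sup_cap xP.
(* An isolated vertex would have an empty sum equal to a supply or capacity of at least 1. *)
have I_nbr i : exists j, E i j.
  apply/existsP; have := sup_ge1 i; apply: contraTT => /existsPn noE.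
  by rewrite -xP.1 big1 // => j Eij; have := noE j; rewrite Eij.
have J_nbr j : exists i, E i j.
  apply/existsP; have := cap_ge1 j; apply: contraTT => /existsPn noE.
  by rewrite -xP.2 big1 // => i Eij; have := noE i; rewrite Eij.
rewrite /has_perfect_proportional_allocation (perfect_OPT xP).
split=> [[al [al0 val]]|cov].
- apply: (@fractional_matching_covered _ _ _ _ _ R
    (proportional_allocation E sup al) _ _ _ _ xP).
  + move=> i j Eij; apply: divr_gt0; first by rewrite mulr_gt0 ?ltr0n.
    exact: (weight_sum_gt0 I_nbr).
  + move=> i; exact: (proportional_row _ I_nbr).
  + exact/(allocation_value_load I_nbr sumE al0).
- have [N [m [m0 ms mc]]] := matching_covered_positive xP cov.
  have [al al0 alP] :=
    loads_eq_cap R I_nbr J_nbr sumE sup_ge1 cap_ge1 m0 ms mc Econn.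
  by exists al; split=> //; apply/(allocation_value_load I_nbr sumE al0).
Qed.
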